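(* Let $\bot=\inf\mathcal{S}$ and $\top=\sup\mathcal{S}$. Assume that the envelope chain hits the set of single point intervals $\mathcal{X}=\{[x,x] : x\in\mathcal{S}\}$ in finite time, i.e. that $$\tau_e \stackrel{\rm{def}}{=} \min\{ n : [\bot,\top]\boxdot u_{-n+1\to 0}\in\mathcal{X}\}$$ is finite. Then $\tau_e$ is a backward coupling time of the envelope chain, and the state defined by $[\bot,\top]\boxdot u_{-\tau_e+1\to 0}$ has the steady state distribution of the DTMC $\{X_n\}_{n\in\mathbb{N}}$.
   Context: $(X_n)$ is an irreducible aperiodic DTMC on a finite state space $\mathcal{S}$, generated by a Markov automaton $(\mathcal{S},A,D,\cdot)$ (a finite set of events $A$ drawn i.i.d. with distribution $D$, acting on states by the transition function $x\mapsto x\cdot a$). $\mathcal{S}$ is equipped with a lattice order $\preceq$; $[m,M]=\{x\in\mathcal{S}: m\preceq x\preceq M\}$. For $U\subset\mathcal{S}$, the envelope of $U$ is the smallest interval containing $U$, namely $[\inf U,\sup U]$. The envelope transition is defined by $[m,M]\boxdot a = [\inf_{m\preceq x\preceq M}\{x\cdot a\}, \sup_{m\preceq x\preceq M}\{x\cdot a\}]$, i.e. the smallest interval containing $[m,M]\cdot a$, extended to words by $[m,M]\boxdot u_{1\to n}=[m,M]\boxdot u_1\boxdot\dots\boxdot u_n$. $(u_0,u_{-1},\dots)$ is an i.i.d. sequence of events with distribution $D$, and $u_{-n+1\to 0}=u_{-n+1}\cdots u_0$. *)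

(* Defs.v *)
(* MathComp / MathComp-Analysis *)
From HB Require Import structures.
From mathcomp Require Import all_boot all_order all_algebra.
From mathcomp Require Import all_classical all_reals all_analysis.

Set Implicit Arguments.
Unset Strict Implicit.
Unset Printing Implicit Defensive.

Import Order.TTheory GRing.Theory Num.Theory.
Import numFieldNormedType.Exports.

Local Open Scope ring_scope.

Section Chains.
Variables (R : realType) (S : finType).

Definition distribution_on (T : finType) (p : T -> R) : Prop :=
  (forall x, 0 <= p x) /\ \sum_x p x = 1.

Fixpoint nstep (Q : S -> S -> R) (n : nat) (x y : S) : R :=
  if n is k.+1 then \sum_z Q x z * nstep Q k z y else (x == y)%:R.

Definition irreducible_kernel (Q : S -> S -> R) : Prop :=
  forall x y, exists n, 0 < nstep Q n x y.

(* The set of return times to x has gcd 1. *)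
Definition aperiodic_kernel (Q : S -> S -> R) : Prop :=
  forall x (d : nat),
    (forall n, (0 < n)%N -> 0 < nstep Q n x x -> (d %| n)%N) -> d = 1%N.

(* Invariant law which is also the limit law from every initial state, hence
   unique. *)
Definition steady_state (Q : S -> S -> R) (p : S -> R) : Prop :=
  [/\ distribution_on p,
      forall y, \sum_x p x * Q x y = p y &
      forall x y, (nstep Q n x y @[n --> \oo] --> p y)%classic].

Definition automaton_kernel (A : finType) (D : A -> R) (act : S -> A -> S)
  (x y : S) : R := \sum_(a | act x a == y) D a.

End Chains.

Section Events.
Variables (R : realType) (d : measure_display) (Omega : measurableType d).
Variables (P : probability Omega R) (A : finType).

Definition iid (D : A -> R) (u : nat -> Omega -> A) : Prop :=
  [/\ forall k a, measurable [set w | u k w = a]%classic,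
      forall k a, P [set w | u k w = a]%classic = (D a)%:E &
      forall (J : seq nat) (B : nat -> {set A}), uniq J ->
        P [set w | forall k, k \in J -> u k w \in B k]%classic
        = (\prod_(k <- J) P [set w | u k w \in B k]%classic)%E].

(* u k stands for the event u_{-k}: the word is u_{-n+1} ... u_0. *)
Definition past_word (u : nat -> Omega -> A) (n : nat) (w : Omega) : seq A :=
  rev (mkseq (fun k => u k w) n).

(* The least n satisfying p, or None (infinity) when there is none. *)
Definition first_time (p : pred nat) : option nat :=
  if pselect (exists n, p n) is left h then Some (ex_minn h) else None.

(* All trajectories started in C at time -n agree at time 0. *)
Definition coupled (T : finType) (C : {set T}) (act : T -> A -> T)
  (s : seq A) : bool := #|[set foldl act x s | x in C]| == 1%N.

(* Backward coupling time of the chain with state space C driven by act. *)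
Definition backward_coupling_time (T : finType) (C : {set T})
    (act : T -> A -> T) (u : nat -> Omega -> A) (tau : Omega -> option nat) :
    Prop :=
  {ae P, forall w, exists n,
    [/\ tau w = Some n, coupled C act (past_word u n w) &
        forall m, coupled C act (past_word u m w) -> (n <= m)%N]}.

End Events.

Section Envelope.
Variables (ds : Order.disp_t) (S : finTBLatticeType ds) (A : finType).
Variable act : S -> A -> S.

Definition interval_of (m M : S) : {set S} :=
  [set x | (m <= x)%O && (x <= M)%O]%SET.

(* State space of the envelope chain: the nonempty intervals. *)
Definition intervals : {set {set S}} :=
  [set interval_of p.1 p.2 | p : S * S & (p.1 <= p.2)%O]%SET.

Definition point_intervals : {set {set S}} := [set interval_of x x | x : S]%SET.

Definition envelope (U : {set S}) : {set S} :=
  interval_of (\meet_(x in U) x)%O (\join_(x in U) x)%O.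

Definition env_act (I : {set S}) (a : A) : {set S} :=
  envelope [set act x a | x in I]%SET.

Variables (d : measure_display) (Omega : measurableType d).

Definition env_past (u : nat -> Omega -> A) (n : nat) (w : Omega) : {set S} :=
  foldl env_act (interval_of \bot%O \top%O) (past_word u n w).

Definition tau_e (u : nat -> Omega -> A) (w : Omega) : option nat :=
  first_time (fun n => env_past u n w \in point_intervals).

End Envelope.

(* Main.v *)
(* The envelope chain started from the whole space encloses every trajectory of
   the chain, and by inclusion every other envelope trajectory, so it is reduced
   to a point exactly when the envelope chain has coupled.  Prepending older
   events shrinks [env_past], so the event F_n(y) that [env_past] at time n is
   {y} increases with n, and its union over n is the event that the sampled state
   is y.  On F_n(y) the word of length n leads every x to y, hence
   P(F_n(y)) <= nstep n x y, whereas the limits p(y) of these lower bounds sum to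
   1 since tau_e is finite: thus nstep n x y tends to p(y) for every x.  This
   limit law is automatically invariant. *)
Require Import Defs.
From mathcomp Require Import all_boot all_order all_algebra.
From mathcomp Require Import all_classical all_reals all_analysis.

Import Order.TTheory GRing.Theory Num.Theory.
Import numFieldNormedType.Exports.

(** * Envelope trajectories, their coupling and the hitting time of the points *)

Section Envelope.
Set Implicit Arguments.
Unset Strict Implicit.
Variables (ds : Order.disp_t) (S : finTBLatticeType ds) (A : finType).
Variable act : S -> A -> S.
Implicit Types (x y : S) (I J : {set S}) (s : seq A).

Lemma interval_of_point x : interval_of x x = [set x]%SET.
Proof. by apply/setP => y; rewrite !inE andbC -eq_le. Qed.

Lemma interval_of_bot_top : interval_of (\bot%O : S) \top%O = [set: S]%SET.
Proof. by apply/setP => y; rewrite !inE le0x lex1. Qed.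

Lemma point_intervalsP I :
  reflect (exists x, I = [set x]%SET) (I \in point_intervals S).
Proof.
apply: (iffP imsetP) => [[x _ ->]|[x ->]]; exists x => //;
  by rewrite interval_of_point.
Qed.

Lemma envelopeS I J : I \subset J -> envelope I \subset envelope J.
Proof.
move=> IJ; apply/fintype.subsetP => x; rewrite !inE => /andP[Ix xI].
apply/andP; split.
  by apply: le_trans Ix; apply/meetsP => i /(fintype.subsetP IJ) iJ; apply: meets_inf.
by apply: le_trans xI _; apply/joinsP => i /(fintype.subsetP IJ) iJ; apply: joins_sup.
Qed.

Lemma env_actS I J a : I \subset J -> env_act act I a \subset env_act act J a.
Proof. by move=> IJ; apply: envelopeS; apply: imsetS. Qed.

Lemma env_act_point x a : env_act act [set x]%SET a = [set act x a]%SET.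
Proof.
by rewrite /env_act imset_set1 /envelope !big_set1 interval_of_point.
Qed.

Lemma env_foldlS s I J :
  I \subset J -> foldl (env_act act) I s \subset foldl (env_act act) J s.
Proof. by elim: s I J => //= a s IH I J IJ; apply: IH; apply: env_actS. Qed.

Lemma env_foldl_point x s :
  foldl (env_act act) [set x]%SET s = [set foldl act x s]%SET.
Proof. by elim: s x => //= a s IH x; rewrite env_act_point IH. Qed.

(** A trajectory is the envelope trajectory of a point interval, so enclosure is an instance of
    monotonicity. *)
Lemma mem_env_foldl x I s :
  x \in I -> foldl act x s \in foldl (env_act act) I s.
Proof.
by move=> xI; rewrite -finset.sub1set -env_foldl_point env_foldlS // finset.sub1set.
Qed.

(** If all envelope trajectories agree, their common value is the one issued from the point [\bot],
    hence a point. Conversely, the trajectory of any interval lies in that of the whole space and is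
    nonempty, so it equals the latter once this is a point. *)
Lemma coupled_env s :
  coupled (intervals S) (env_act act) s =
  (foldl (env_act act) (interval_of \bot%O \top%O) s \in point_intervals S).
Proof.
have mem_int x y : (x <= y)%O -> interval_of x y \in intervals S.
  by move=> xy; apply/imsetP; exists (x, y); rewrite ?inE.
apply/idP/point_intervalsP => [/cards1P[E imE]|[y Ey]].
  have img I : I \in intervals S -> foldl (env_act act) I s = E.
    by move=> ?; apply/set1P; rewrite -imE imset_f.
  exists (foldl act \bot%O s); rewrite -env_foldl_point -interval_of_point.
  by rewrite !img ?mem_int ?le0x.
apply/cards1P; exists [set y]%SET; apply/setP => E; rewrite !inE.
apply/imsetP/eqP => [[I /imsetP[[m M]]] /=|->].
  rewrite inE /= => mM -> ->; set J := interval_of m M.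
  have mJ : m \in J by rewrite inE lexx.
  have := env_foldlS s (finset.subsetT J); rewrite -interval_of_bot_top Ey.
  rewrite finset.subset1 => /orP[/eqP//|/eqP J0].
  by have := mem_env_foldl s mJ; rewrite J0 inE.
by exists (interval_of \bot%O \top%O); rewrite ?mem_int ?le0x.
Qed.

Lemma past_wordS (d : measure_display) (Omega : measurableType d)
    (u : nat -> Omega -> A) n w :
  past_word u n.+1 w = u n w :: past_word u n w.
Proof. by rewrite /past_word mkseqS rev_rcons. Qed.

Lemma first_timeP (p : pred nat) n :
  first_time p = Some n <-> p n /\ forall m, p m -> (n <= m)%N.
Proof.
rewrite /first_time; case: pselect => [h|nh]; last first.
  by split => // -[pn]; case: nh; exists n.
case: ex_minnP => k pk kmin; split => [[<-//]|[pn nmin]]; congr Some.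
by apply/eqP; rewrite eqn_leq kmin // nmin.
Qed.

Variables (d : measure_display) (Omega : measurableType d).
Variable u : nat -> Omega -> A.

(** Going one step further back prepends [u n]; after this letter the interval is some subset of the
    whole space, and monotonicity handles the rest of the word. *)
Lemma env_past_decreasing n w :
  env_past act u n.+1 w \subset env_past act u n w.
Proof.
rewrite /env_past past_wordS /=; apply: env_foldlS.
by rewrite interval_of_bot_top finset.subsetT.
Qed.

Lemma foldl_in_env_past x n w :
  foldl act x (past_word u n w) \in env_past act u n w.
Proof. by apply: mem_env_foldl; rewrite interval_of_bot_top inE. Qed.

Lemma env_past_point_stable x n m w : (n <= m)%N ->
  env_past act u n w = [set x]%SET -> env_past act u m w = [set x]%SET.
Proof.
move=> /subnKC <- nx; elim: (m - n)%N => [|k IH]; first by rewrite addn0.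
have := env_past_decreasing (n + k) w; rewrite -addnS IH finset.subset1.
(* The empty set is excluded because envelopes contain every trajectory. *)
case/orP => /eqP // E0.
by have := foldl_in_env_past x (n + k.+1) w; rewrite E0 inE.
Qed.

(** Once reached, a point persists, so the state sampled at [tau_e] can be read at any later time.
    This removes the random time from the event. *)
Lemma tau_e_point_bigcup x :
  [set w | exists2 n, tau_e act u w = Some n &
                      env_past act u n w = interval_of x x]%classic =
  (\bigcup_n [set w | env_past act u n w == [set x]%SET])%classic.
Proof.
apply/seteqP; split => w /= [n]; rewrite ?interval_of_point.
  by move=> _ /eqP nx; exists n.
move=> _ /= /eqP nx.
have pn : env_past act u n w \in point_intervals S.
  by apply/point_intervalsP; exists x.
(* At the least time [k] the point could a priori differ from [x]; stability from [k] to [n]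
   identifies the two. *)
have [k pk kmin] : exists2 k, env_past act u k w \in point_intervals S &
    forall m, env_past act u m w \in point_intervals S -> (k <= m)%N.
  by case: (ex_minnP (ex_intro (fun m => env_past act u m w \in _) n pn)) => k;
    exists k.
exists k; first by apply/first_timeP.
have /point_intervalsP[y ky] := pk; rewrite ky -nx.
by rewrite (env_past_point_stable (kmin _ pn) ky).
Qed.

End Envelope.

(** * Finite additivity over disjoint events *)

Section Measure.
Set Implicit Arguments.
Unset Strict Implicit.
Local Open Scope classical_set_scope.
Local Open Scope ring_scope.

Lemma fin_disjoint_measure (R : realType) (d : measure_display)
    (Omega : measurableType d) (mu : {measure set Omega -> \bar R})
    (T : finType) (F : T -> set Omega) :
  (forall i, measurable (F i)) -> trivIset setT F ->
  mu (\bigcup_i F i) = (\sum_i mu (F i))%E.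
Proof.
move=> mF tF; rewrite measure_fin_bigcup //; last exact: finite_finset.
rewrite [RHS]fsbig_seq ?index_enum_uniq //.
rewrite (_ : [set` index_enum T] = [set: T]) //.
by apply/seteqP; split => i //= _; rewrite mem_index_enum.
Qed.

End Measure.

(** * Law of the state reached by reading a past word *)

Section PastWord.
Set Implicit Arguments.
Unset Strict Implicit.
Local Open Scope classical_set_scope.
Local Open Scope ring_scope.
Variables (R : realType) (d : measure_display) (Omega : measurableType d).
Variables (P : probability Omega R) (S A : finType) (D : A -> R).
Variables (act : S -> A -> S) (u : nat -> Omega -> A).
Hypothesis hu : iid P D u.

Let mu_event k a : measurable [set w | u k w = a].
Proof. by case: hu. Qed.

(** Split according to the oldest letter, which is absorbed into the predicate; hence the induction
    is for all [f]. *)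
Lemma measurable_past_word (f : pred (seq A)) n :
  measurable [set w | f (past_word u n w)].
Proof.
elim: n f => [|n IH] f.
  rewrite /past_word /=; case: (f [::]).
    rewrite (_ : mkset _ = [set: Omega]); first exact: measurableT.
    by apply/seteqP; split.
  rewrite (_ : mkset _ = set0); first exact: measurable0.
  by apply/seteqP; split.
rewrite [X in measurable X](_ : _ = \bigcup_a
    ([set w | u n w = a] `&` [set w | f (a :: past_word u n w)])).
  apply: fin_bigcup_measurable; first exact: finite_finset.
  by move=> a _; apply: measurableI; [exact: mu_event|exact: (IH (f \o cons a))].
apply/seteqP; split => w /=; rewrite past_wordS; first by exists (u n w).
by case=> a _ [/= ->].
Qed.

Lemma iid_joint_events (J : seq nat) (b : nat -> A) : uniq J ->
  P [set w | forall k, k \in J -> u k w = b k] = (\prod_(k <- J) D (b k))%:E.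
Proof.
case: hu => _ uD uI uJ; have := uI J (fun k => [set b k]%SET) uJ.
have E : [set w | forall k, k \in J -> u k w \in [set b k]%SET] =
    [set w | forall k, k \in J -> u k w = b k].
  by apply/seteqP; split => w /= H k /H; rewrite inE => /eqP.
rewrite E => ->; rewrite -prodEFin; apply: eq_bigr => k _; rewrite -(uD k).
by congr (P _); apply/seteqP; split => w /=; rewrite inE => /eqP.
Qed.

(* The induction runs from the oldest letter [u n] of the word, so it must carry
   the letters already read off (with indices at least [n]) along. *)
Lemma past_word_law_joint n x y (J : seq nat) (b : nat -> A) :
  uniq J -> (forall k, k \in J -> (n <= k)%N) ->
  P ([set w | foldl act x (past_word u n w) == y] `&`
     [set w | forall k, k \in J -> u k w = b k]) =
  (nstep (automaton_kernel D act) n x y * \prod_(k <- J) D (b k))%:E.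
Proof.
elim: n x J b => [|n IH] x J b uJ nJ.
  rewrite /past_word /=; case: (x == y).
    by rewrite mul1r -iid_joint_events //; congr (P _);
      apply/seteqP; split => w //= -[].
  rewrite mul0r; transitivity (P set0); last exact: measure0.
  by congr (P _); apply/seteqP; split => w //= -[].
have nnJ : n \notin J by apply/negP => /nJ; rewrite ltnn.
(* [c a] extends the prescription [b] by the letter [a] at index [n], so that the induction
   hypothesis applies to [F a] with [n :: J]. *)
pose c a k := if k == n then a else b k.
pose F a := [set w | foldl act (act x a) (past_word u n w) == y] `&`
            [set w | forall k, k \in n :: J -> u k w = c a k].
have FE : [set w | foldl act x (past_word u n.+1 w) == y] `&`
    [set w | forall k, k \in J -> u k w = b k] = \bigcup_a F a.
  apply/seteqP; split => w /=; rewrite past_wordS /=.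
    move=> [uy uJb]; exists (u n w) => //; split => //= k.
    rewrite inE /c; case: eqP => [->//|_ /=]; exact: uJb.
  move=> [a _ [/= uy uc]]; have := uc n (mem_head _ _).
  rewrite {1}/c eqxx => ->; split => // k kJ.
  have := uc k; rewrite inE kJ orbT /c => ->//.
  by case: eqP kJ => // ->; rewrite (negbTE nnJ).
have PF a : P (F a) = (D a * nstep (automaton_kernel D act) n (act x a) y *
    \prod_(k <- J) D (b k))%:E.
  rewrite IH /= ?nnJ //; last first.
    by move=> k; rewrite inE => /predU1P[->//|/nJ/ltnW].
  rewrite big_cons {1}/c eqxx mulrCA mulrA; congr (_ * _)%:E.
  rewrite !big_seq; apply: eq_bigr => k kJ; rewrite /c.
  by case: eqP kJ => // ->; rewrite (negbTE nnJ).
have mF a : measurable (F a).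
  apply: measurableI.
    exact: (measurable_past_word (fun s => foldl act (act x a) s == y)).
  apply: fin_bigcap_measurable => [|k _]; first exact: finite_seq.
  exact: mu_event.
rewrite FE fin_disjoint_measure //; last first.
  move=> a a' _ _ [w [[_ /(_ n (mem_head _ _)) wa] [_ /(_ n (mem_head _ _))]]].
  by rewrite wa /c eqxx.
rewrite (eq_bigr _ (fun a _ => PF a)) sumEFin; congr (_%:E).
rewrite -mulr_suml; congr (_ * _) => /=.
(* Grouping the letters by the state they lead to recovers one step of the kernel. *)
rewrite (partition_big (act x) xpredT) //=; apply: eq_bigr => z _.
rewrite /automaton_kernel mulr_suml; apply: eq_bigr => a.
by move=> /eqP ->.
Qed.

(** The letter [a] is a default value for the prescription on the empty list of indices. *)
Lemma past_word_law (a : A) n x y :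
  P [set w | foldl act x (past_word u n w) == y] =
  (nstep (automaton_kernel D act) n x y)%:E.
Proof.
have := @past_word_law_joint n x y [::] (fun=> a).
rewrite big_nil mulr1 => <- //; congr (P _).
by apply/seteqP; split => w //= -[].
Qed.

End PastWord.

(** * Convergence of finite kernels and invariance of the limit *)

Section Kernel.
Set Implicit Arguments.
Unset Strict Implicit.
Local Open Scope classical_set_scope.
Local Open Scope ring_scope.
Variables (R : realType) (S : finType).
Implicit Types (Q : S -> S -> R) (p : S -> R).

(** [nstep] unfolds at its first step, whereas invariance of a limit law needs the last one. *)
Lemma nstepSr Q n x y : nstep Q n.+1 x y = \sum_z nstep Q n x z * Q z y.
Proof.
elim: n x => [|n IH] x.
  rewrite /= (bigD1 y) //= eqxx mulr1 [RHS](bigD1 x) //= eqxx mul1r.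
  rewrite !big1 // => z zy; first by rewrite eq_sym (negbTE zy) mul0r.
  by rewrite (negbTE zy) mulr0.
rewrite [LHS]/= (eq_bigr _ (fun z _ => congr1 _ (IH z))).
under eq_bigr do rewrite mulr_sumr.
rewrite exchange_big /=; apply: eq_bigr => t _.
by rewrite mulr_suml; apply: eq_bigr => z _; rewrite mulrA.
Qed.

Lemma nstep_sum1 Q n x :
  (forall y, \sum_z Q y z = 1) -> \sum_y nstep Q n x y = 1.
Proof.
move=> Q1; elim: n x => [|n IH] x.
  rewrite (bigD1 x) //= eqxx big1 ?addr0 // => y /negbTE yx.
  by rewrite eq_sym yx.
rewrite exchange_big /= -[RHS](Q1 x); apply: eq_bigr => z _.
by rewrite -mulr_sumr IH mulr1.
Qed.

Lemma nstep_ge0 Q n x y : (forall y z, 0 <= Q y z) -> 0 <= nstep Q n x y.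
Proof.
by move=> Q0; elim: n x => [|n IH] x //=; apply: sumr_ge0 => z _; rewrite mulr_ge0.
Qed.

Lemma cvg_fin_sum (T : finType) (a : pred T) (f : T -> nat -> R) (l : T -> R) :
  (forall i, f i n @[n --> \oo] --> l i) ->
  \sum_(i | a i) f i n @[n --> \oo] --> \sum_(i | a i) l i.
Proof. by move=> fl; apply: cvg_big => //; exact: add_continuous. Qed.

(* Lower bounds that converge without loss of mass leave no room above them:
   [f y = 1 - \sum_(z != y) f z <= 1 - \sum_(z != y) g z]. *)
Lemma cvg_distribution_minorant (f g : nat -> S -> R) p :
  (forall n, \sum_y f n y = 1) -> \sum_y p y = 1 ->
  (forall n y, g n y <= f n y) ->
  (forall y, g n y @[n --> \oo] --> p y) ->
  forall y, f n y @[n --> \oo] --> p y.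
Proof.
move=> f1 p1 gf gp y.
apply: (squeeze_cvgr (f := g ^~ y) (h := fun n => 1 - \sum_(z | z != y) g n z)).
- apply: nearW => n; rewrite gf lerBrDr /= -(f1 n) [leRHS](bigD1 y) //= lerD2l.
  exact: ler_sum.
- exact: gp.
rewrite (_ : p y = 1 - \sum_(z | z != y) p z).
  apply: cvgB; first exact: cvg_cst.
  exact: (cvg_fin_sum (f := fun z n => g n z)).
by rewrite -p1 (bigD1 y) //= addrK.
Qed.

(** Finite sums commute with limits, so total mass and the recursion on the last step both pass to
    the limit from [x0]. *)
Lemma limit_steady_state Q p (x0 : S) :
  (forall y z, 0 <= Q y z) -> (forall y, \sum_z Q y z = 1) ->
  (forall x y, nstep Q n x y @[n --> \oo] --> p y) -> steady_state Q p.
Proof.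
move=> Q0 Q1 Qp; split=> //; first split=> [y|].
- by apply: (cvgr_to_ge (Qp x0 y)); apply: nearW => n; exact: nstep_ge0.
- have := cvg_fin_sum (a := xpredT) (fun y => Qp x0 y).
  rewrite (_ : (fun n => _) = cst 1); last first.
    by apply/funext => n; rewrite nstep_sum1.
  by move=> /(cvg_lim (@Rhausdorff R)) <-; rewrite lim_cst.
- move=> y.
  have pQ : \sum_x nstep Q n x0 x * Q x y @[n --> \oo] --> \sum_x p x * Q x y.
    apply: (cvg_fin_sum (f := fun x n => nstep Q n x0 x * Q x y)) => x.
    by apply: cvgM; [exact: Qp|exact: cvg_cst].
  rewrite -(cvg_lim (@Rhausdorff R) pQ).
  under eq_fun do rewrite -nstepSr.
  apply: (cvg_lim (@Rhausdorff R)).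
  by rewrite (cvg_shiftS (fun n => nstep Q n x0 y)); exact: Qp.
Qed.

Lemma automaton_kernel_ge0 (A : finType) (D : A -> R) (act : S -> A -> S) x y :
  distribution_on D -> 0 <= automaton_kernel D act x y.
Proof. by case=> D0 _; exact: sumr_ge0. Qed.

Lemma automaton_kernel_sum1 (A : finType) (D : A -> R) (act : S -> A -> S) x :
  distribution_on D -> \sum_y automaton_kernel D act x y = 1.
Proof. by case=> _ <-; rewrite [RHS](partition_big (act x) xpredT). Qed.

End Kernel.

Theorem theorem2 (R : realType) (ds : Order.disp_t) (S : finTBLatticeType ds)
    (A : finType) (D : A -> R) (act : S -> A -> S)
    (d : measure_display) (Omega : measurableType d) (P : probability Omega R)
    (u : nat -> Omega -> A)
    (hD : distribution_on D)
    (hirr : irreducible_kernel (automaton_kernel D act))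
    (haper : aperiodic_kernel (automaton_kernel D act))
    (hu : iid P D u)
    (htau : {ae P, forall w, exists n, tau_e act u w = Some n}) :
  backward_coupling_time P (intervals S) (env_act act) u (tau_e act u) /\
  exists2 p : S -> R,
    steady_state (automaton_kernel D act) p &
    forall x : S,
      P [set w | exists2 n, tau_e act u w = Some n &
                            env_past act u n w = interval_of x x]%classic
      = (p x)%:E.
Proof.
split.
  apply: filterS htau => w [n tn]; have /first_timeP[pn nmin] := tn.
  exists n; split=> //; first by rewrite coupled_env.
  by move=> m; rewrite coupled_env; exact: nmin.
(* An empty alphabet could not carry total mass 1. *)
have [a0 _] : exists a : A, true.
  case: (pickP A) => [a _|A0]; first by exists a.
  by case: hD => _; rewrite big_pred0 // => /eqP; rewrite eq_sym oner_eq0.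
pose F y n := [set w | env_past act u n w == [set y]%SET]%classic.
pose E y := (\bigcup_n F y n)%classic.
have mF y n : measurable (F y n).
  exact: (measurable_past_word hu (fun s =>
    foldl (env_act act) (interval_of \bot%O \top%O) s == [set y]%SET)).
have mE y : measurable (E y) by apply: bigcup_measurable.
have ndF y : nondecreasing_seq (F y).
  move=> m n mn; apply/subsetPset => w /eqP my; apply/eqP.
  exact: env_past_point_stable my.
have tE : trivIset setT E.
  (* Points reached at times [m] and [n] are compared at time [maxn m n]. *)
  move=> y z _ _ [w [[m _ /eqP my] [n _ /eqP nz]]]; apply/set1P.
  rewrite -(env_past_point_stable (leq_maxr m n) nz).
  by rewrite (env_past_point_stable (leq_maxl m n) my) inE.
have PE1 : (\sum_y P (E y) = 1)%E.
  rewrite -fin_disjoint_measure //; set B := (\bigcup_y E y)%classic.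
  have mB : measurable B.
    by apply: fin_bigcup_measurable => //; exact: finite_finset.
  (* Outside [B] no point is ever reached, so [tau_e] is infinite there. *)
  have B0 : P (~` B)%classic = 0%E.
    apply: measure_negligible; first exact: measurableC.
    apply: negligibleS htau => w /= nB [n /first_timeP[]].
    move=> /point_intervalsP[y ny] _; apply: nB; exists y => //.
    by exists n => //; apply/eqP.
  rewrite -[B]setCK; apply: etrans (probability_setC P (measurableC mB)) _.
  by rewrite B0 sube0.
pose p y := fine (P (E y)).
have pE y : P (E y) = (p y)%:E by rewrite fineK // fin_num_measure.
exists p; last by move=> x; rewrite tau_e_point_bigcup pE.
apply: (limit_steady_state \bot%O).
- by move=> y z; exact: automaton_kernel_ge0.
- by move=> y; exact: automaton_kernel_sum1.
move=> x.
apply: (cvg_distribution_minorant (g := fun n y => fine (P (F y n)))).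
- by move=> n; apply: nstep_sum1 => y; exact: automaton_kernel_sum1.
- by apply: EFin_inj; rewrite -sumEFin -PE1; apply: eq_bigr => y _; rewrite pE.
(* The trajectory from [x] lies in the envelope, so it ends in [y] when the envelope is the point
   [y]. *)
- move=> n y; rewrite -lee_fin fineK ?fin_num_measure //.
  rewrite -(past_word_law act hu a0); apply: le_measure; rewrite ?inE //.
    exact: (measurable_past_word hu (fun s => foldl act x s == y)).
  move=> w /= /eqP ny.
  by have := foldl_in_env_past act u x n w; rewrite ny inE.
(* Continuity from below along the increasing events [F y]. *)
move=> y; apply: fine_cvg; rewrite -pE.
exact: (nondecreasing_cvg_mu (mF y) (mE y) (ndF y)).
Qed.
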